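(* In base $3$, the successor graph $G_s$ does not contain an infinite path; that is, there is no infinite sequence of positive integers $a(1), a(2), a(3), \ldots$ such that $a(n+1)$ is the comma-successor of $a(n)$ in base $3$ for every $n \ge 1$.
   Context: Work in base $b = 3$. For a positive integer $n$, let $\delta(n)$ denote its leading (most significant, nonzero) base-$b$ digit. For positive integers $k, k'$, we say that $k'$ is a comma-child of $k$ (in base $b$) if $k' - k = d\cdot b + \delta(k')$, where $d = k \bmod b$ is the last base-$b$ digit of $k$. If $k$ has at least one comma-child, the comma-successor of $k$ is its smallest comma-child; otherwise $k$ has no comma-successor. The successor graph $G_s$ (in base $b$) is the directed graph whose nodes are the positive integers, with an edge from $i$ to $j$ exactly when $j$ is the comma-successor of $i$. Paths are directed paths. *)

(* Defs.v *)
From mathcomp Require Import all_boot.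

Set Implicit Arguments.
Unset Strict Implicit.
Unset Printing Implicit Defensive.

(* Meaningful for 1 < b and 0 < n: trunc_log b n is then the position of the
   most significant base-b digit of n, counted from 0. *)
Definition leading_digit (b n : nat) : nat := n %/ b ^ trunc_log b n.

Definition last_digit (b n : nat) : nat := n %% b.

(* The condition k' - k = d * b + delta(k') is written additively because
   subtraction on nat is truncated. *)
Definition comma_child (b k k' : nat) : Prop :=
  [/\ 0 < k, 0 < k' & k' = k + (last_digit b k * b + leading_digit b k')].

Definition comma_successor (b k k' : nat) : Prop :=
  comma_child b k k' /\ (forall j : nat, comma_child b k j -> k' <= j).

(* Edge relation of the graph G_s; its nodes are the positive integers, and
   comma_child already forces both endpoints to be positive. *)
Definition successor_graph (b i j : nat) : Prop := comma_successor b i j.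

(* As in the source, sequences start at index 1; the value a 0 is irrelevant. *)
Definition infinite_path (E : nat -> nat -> Prop) (a : nat -> nat) : Prop :=
  forall n : nat, 1 <= n -> E (a n) (a n.+1).

(* Main.v *)
Require Import Defs.
From mathcomp Require Import all_boot.
From mathcomp Require Import zify.

Set Implicit Arguments.
Unset Strict Implicit.
Unset Printing Implicit Defensive.

(** While the leading digit is 1, a path repeats the increments 1, 4, 7 and so
    advances by 12 from one multiple of 3 to the next; while it is 2, the
    increments are 2, 8, 5 and the period is 15.  Hence the first multiple
    [3^m + e] of 3 met from [3^m] on ([e] in {0, 3, 6, 9}) determines the
    first one met from [3^m.+1] on, through a map depending only on [e] and
    on [3^m %% 60], which has period 4 in [m].  The path stops exactly when it
    reaches [3^m.+1 - 5].  Starting at [m = 1 %[mod 4]], every [e] leads to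
    such a dead end before the path has passed six more powers of 3. *)

(** * Leading digits and comma-children in base 3 *)

Lemma leading_digit3_1 m x :
  3 ^ m <= x < 2 * 3 ^ m -> leading_digit 3 x = 1.
Proof.
move=> /andP[lo hi]; have pos : 0 < 3 ^ m by rewrite expn_gt0.
rewrite /leading_digit (@trunc_log_eq 3 m) //; last by rewrite lo expnS; lia.
have -> : x = 1 * 3 ^ m + (x - 3 ^ m) by lia.
by rewrite divnMDl // divn_small //; lia.
Qed.

Lemma leading_digit3_2 m x :
  2 * 3 ^ m <= x < 3 ^ m.+1 -> leading_digit 3 x = 2.
Proof.
move=> /andP[lo hi]; have pos : 0 < 3 ^ m by rewrite expn_gt0.
rewrite /leading_digit (@trunc_log_eq 3 m) //; last by rewrite hi; lia.
move: hi; rewrite expnS => hi.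
have -> : x = 2 * 3 ^ m + (x - 2 * 3 ^ m) by lia.
by rewrite divnMDl // divn_small //; lia.
Qed.

Lemma leading_digit3 x : 0 < x -> leading_digit 3 x = 1 \/ leading_digit 3 x = 2.
Proof.
move=> x_gt0; have /andP[lo hi] := trunc_log_bounds (isT : 1 < 3) x_gt0.
case: (ltnP x (2 * 3 ^ trunc_log 3 x)) => h; [left|right].
- by apply: (@leading_digit3_1 (trunc_log 3 x)); rewrite lo h.
- by apply: (@leading_digit3_2 (trunc_log 3 x)); rewrite h hi.
Qed.

Lemma comma_child3_cases k k' : comma_child 3 k k' ->
  k' = k + 3 * (k %% 3) + leading_digit 3 k' /\
  (leading_digit 3 k' = 1 \/ leading_digit 3 k' = 2).
Proof.
case=> _ k'_gt0 eq_k'; split; last exact: leading_digit3.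
by rewrite {1}eq_k' /last_digit mulnC addnA.
Qed.

(** Abstracts the set of values of an infinite path, so that following the path needs no indices. *)
Definition succ_closed (V : nat -> Prop) : Prop :=
  forall x, V x -> exists2 y, comma_successor 3 x y & V y.

(* With [r] the residue of [3 ^ m] modulo 60, [(r + 12 - e) %% 12] is the
   distance to [2 * 3 ^ m], modulo 12, of the last multiple of 3 of the form
   [3 ^ m + e + 12 * j] below it. *)
Definition offset_at_two (r e : nat) : nat :=
  nth 0 [:: 6; 3; 12; 9] (((r + 12 - e) %% 12) %/ 3).

(* [None]: the path stops at [3 ^ m.+1 - 5]. *)
Definition offset_at_next_power (r e : nat) : option nat :=
  nth None [:: None; Some 6; Some 3; Some 0; Some 9] (((r + 15 - e) %% 15) %/ 3).

(** Gives [lia] divisibility by 3 and enough room: 27 = 12 + 15 covers the largest offset plus one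
    period, so the truncated subtractions defining [j] below are exact. *)
Lemma pow3_ge27_mul3 m : 2 < m -> 3 ^ m = 3 * 3 ^ m.-1 /\ 27 <= 3 ^ m.
Proof.
by case: m => // m m_gt2; rewrite -expnS; split=> //; apply: (@leq_pexp2l 3 3).
Qed.

(** * Single steps of a path *)

Section Steps.

Context (V : nat -> Prop) (Vsucc : succ_closed V).

(** With leading digit 1 the smaller of the two candidates is a child, hence the successor. *)
Lemma step_leading1 m x : V x ->
  3 ^ m <= x + 3 * (x %% 3) + 1 < 2 * 3 ^ m -> V (x + 3 * (x %% 3) + 1).
Proof.
move=> Vx range; have [y [child_y min_y] Vy] := Vsucc Vx.
have [eq_y dig_y] := comma_child3_cases child_y.
have x_gt0 : 0 < x by case: child_y.
have : y <= x + 3 * (x %% 3) + 1.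
  apply: min_y; split=> //; first by rewrite addn1.
  by rewrite (leading_digit3_1 range) /last_digit mulnC addnA.
move=> le_y; suff <- : y = x + 3 * (x %% 3) + 1 by [].
by case: dig_y eq_y => ->; lia.
Qed.

(** The smaller candidate would need leading digit 1 but lies in the range of leading digit 2, so
    only the larger one remains. *)
Lemma step_leading2 m x : V x ->
  2 * 3 ^ m <= x + 3 * (x %% 3) + 1 -> x + 3 * (x %% 3) + 2 < 3 ^ m.+1 ->
  V (x + 3 * (x %% 3) + 2).
Proof.
move=> Vx lo hi; have [y [child_y _] Vy] := Vsucc Vx.
have [eq_y dig_y] := comma_child3_cases child_y.
case: dig_y => dig_y; last by rewrite dig_y in eq_y; rewrite -eq_y.
have : leading_digit 3 y = 2.
  by apply: (@leading_digit3_2 m); rewrite eq_y dig_y lo; lia.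
by rewrite dig_y.
Qed.

(** Otherwise both candidates fail: [3 ^ m.+1 - 1] starts with 2 where 1 is required, and [3 ^ m.+1]
    starts with 1 where 2 is required. *)
Lemma no_step m x : V x -> x + 3 * (x %% 3) + 2 <> 3 ^ m.+1.
Proof.
move=> Vx eq_x; have [y [child_y _] _] := Vsucc Vx.
have pos : 0 < 3 ^ m by rewrite expn_gt0.
have [eq_y [dig_y|dig_y]] := comma_child3_cases child_y.
- have : leading_digit 3 y = 2.
    by apply: (@leading_digit3_2 m); move: eq_x; rewrite expnS; lia.
  by rewrite dig_y.
- have : leading_digit 3 y = 1.
    by apply: (@leading_digit3_1 m.+1); move: eq_x; rewrite expnS; lia.
  by rewrite dig_y.
Qed.

(** A separate target [y] can be given in closed form, leaving the digit arithmetic to [lia]. *)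
Lemma goto_leading1 m x y : V x -> y = x + 3 * (x %% 3) + 1 ->
  3 ^ m <= y < 2 * 3 ^ m -> V y.
Proof. by move=> Vx ->; apply: step_leading1. Qed.

(** The lower bound is strict because the rejected candidate [y - 1] must already start with 2. *)
Lemma goto_leading2 m x y : V x -> y = x + 3 * (x %% 3) + 2 ->
  2 * 3 ^ m < y < 3 ^ m.+1 -> V y.
Proof.
by move=> Vx -> /andP[lo hi]; apply: (@step_leading2 m) => //; lia.
Qed.

(** * Full periods, and crossings where the leading digit changes *)

Lemma period_leading1 m x j : 3 %| x -> 3 ^ m <= x -> V x ->
  x + 12 * j < 2 * 3 ^ m -> V (x + 12 * j).
Proof.
move=> x3 lo Vx; elim: j => [|j IHj] hi; first by rewrite muln0 addn0.
have V0 : V (x + 12 * j) by apply: IHj; lia.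
have V1 : V (x + 12 * j + 1) by apply: (@goto_leading1 m _ _ V0); lia.
have V2 : V (x + 12 * j + 5) by apply: (@goto_leading1 m _ _ V1); lia.
by apply: (@goto_leading1 m _ _ V2); lia.
Qed.

Lemma period_leading2 m x j : 3 %| x -> 2 * 3 ^ m <= x -> V x ->
  x + 15 * j < 3 ^ m.+1 -> V (x + 15 * j).
Proof.
move=> x3 lo Vx; elim: j => [|j IHj] hi; first by rewrite muln0 addn0.
have V0 : V (x + 15 * j) by apply: IHj; lia.
have V1 : V (x + 15 * j + 2) by apply: (@goto_leading2 m _ _ V0); lia.
have V2 : V (x + 15 * j + 10) by apply: (@goto_leading2 m _ _ V1); lia.
by apply: (@goto_leading2 m _ _ V2); lia.
Qed.

(** Here [x] starts the last period strictly below [2 * 3 ^ m]; a distance of a whole period,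
    [i = 4], wraps to index 0. *)
Lemma cross_two m x i : 2 < m -> 0 < i < 5 -> x + 3 * i = 2 * 3 ^ m -> V x ->
  V (2 * 3 ^ m + nth 0 [:: 6; 3; 12; 9] (i %% 4)).
Proof.
move=> m_gt2 range_i eq_x Vx; have [M_eq M_big] := pow3_ge27_mul3 m_gt2.
have P_eq := expnS 3 m.
have {range_i} : i \in [:: 1; 2; 3; 4] by rewrite !inE; lia.
rewrite !inE => /or4P[] /eqP i_eq; subst i; rewrite /=.
- have V1 : V (2 * 3 ^ m - 2) by apply: (@goto_leading1 m _ _ Vx); lia.
  by apply: (@goto_leading2 m _ _ V1); lia.
- have V1 : V (2 * 3 ^ m - 5) by apply: (@goto_leading1 m _ _ Vx); lia.
  have V2 : V (2 * 3 ^ m - 1) by apply: (@goto_leading1 m _ _ V1); lia.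
  have V3 : V (2 * 3 ^ m + 7) by apply: (@goto_leading2 m _ _ V2); lia.
  by apply: (@goto_leading2 m _ _ V3); lia.
- have V1 : V (2 * 3 ^ m - 8) by apply: (@goto_leading1 m _ _ Vx); lia.
  have V2 : V (2 * 3 ^ m - 4) by apply: (@goto_leading1 m _ _ V1); lia.
  have V3 : V (2 * 3 ^ m + 4) by apply: (@goto_leading2 m _ _ V2); lia.
  by apply: (@goto_leading2 m _ _ V3); lia.
- have V1 : V (2 * 3 ^ m - 11) by apply: (@goto_leading1 m _ _ Vx); lia.
  have V2 : V (2 * 3 ^ m - 7) by apply: (@goto_leading1 m _ _ V1); lia.
  have V3 : V (2 * 3 ^ m + 1) by apply: (@goto_leading2 m _ _ V2); lia.
  by apply: (@goto_leading2 m _ _ V3); lia.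
Qed.

Lemma cross_next_power m x i : 2 < m -> 0 < i < 6 ->
  x + 3 * i = 3 ^ m.+1 -> V x ->
  exists2 e, nth None [:: None; Some 6; Some 3; Some 0; Some 9] (i %% 5) = Some e
           & V (3 ^ m.+1 + e).
Proof.
move=> m_gt2 range_i eq_x Vx; have [M_eq M_big] := pow3_ge27_mul3 m_gt2.
have P_eq := expnS 3 m.
have {range_i} : i \in [:: 1; 2; 3; 4; 5] by rewrite !inE; lia.
rewrite !inE => /or4P[| | |/orP[]] /eqP i_eq; subst i; rewrite /=.
- exists 6 => //; have V1 : V (3 ^ m.+1 - 1) by apply: (@goto_leading2 m _ _ Vx); lia.
  by apply: (@goto_leading1 m.+1 _ _ V1); lia.
- exists 3 => //; have V1 : V (3 ^ m.+1 - 4) by apply: (@goto_leading2 m _ _ Vx); lia.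
  by apply: (@goto_leading1 m.+1 _ _ V1); lia.
- exists 0 => //; have V1 : V (3 ^ m.+1 - 7) by apply: (@goto_leading2 m _ _ Vx); lia.
  by apply: (@goto_leading1 m.+1 _ _ V1); lia.
- exists 9 => //; have V1 : V (3 ^ m.+1 - 10) by apply: (@goto_leading2 m _ _ Vx); lia.
  have V2 : V (3 ^ m.+1 - 2) by apply: (@goto_leading2 m _ _ V1); lia.
  have V3 : V (3 ^ m.+1 + 2) by apply: (@goto_leading1 m.+1 _ _ V2); lia.
  by apply: (@goto_leading1 m.+1 _ _ V3); lia.
- have V1 : V (3 ^ m.+1 - 13) by apply: (@goto_leading2 m _ _ Vx); lia.
  have V2 : V (3 ^ m.+1 - 5) by apply: (@goto_leading2 m _ _ V1); lia.
  by have := @no_step m _ V2; lia.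
Qed.

(** * From one power of 3 to the next *)

Lemma reach_two m r e : 2 < m -> 3 ^ m = r %[mod 60] -> e <= 9 -> 3 %| e ->
  V (3 ^ m + e) -> V (2 * 3 ^ m + offset_at_two r e).
Proof.
move=> m_gt2 mod_r e_le e3 Ve; have [M_eq M_big] := pow3_ge27_mul3 m_gt2.
have [i range_i i_mod] : exists2 i, 0 < i < 5 & 3 ^ m = e + 3 * i %[mod 12].
  (* Shifting by 1 before reducing picks the representative in 1 to 4 instead of 0 to 3. *)
  by exists (((3 ^ m + 11 - e) %% 12) %/ 3 + 1); lia.
have -> : offset_at_two r e = nth 0 [:: 6; 3; 12; 9] (i %% 4).
  by congr nth; lia.
pose j := (3 ^ m - e - 3 * i) %/ 12.
apply: (@cross_two m (3 ^ m + e + 12 * j)) => //; first by lia.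
by apply: (@period_leading1 m) => //; lia.
Qed.

Lemma reach_next_power m r e : 2 < m -> 3 ^ m = r %[mod 60] -> e <= 12 ->
  3 %| e -> V (2 * 3 ^ m + e) ->
  exists2 e', offset_at_next_power r e = Some e' & V (3 ^ m.+1 + e').
Proof.
move=> m_gt2 mod_r e_le e3 Ve; have [M_eq M_big] := pow3_ge27_mul3 m_gt2.
have P_eq := expnS 3 m.
have [i range_i i_mod] : exists2 i, 0 < i < 6 & 3 ^ m = e + 3 * i %[mod 15].
  by exists (((3 ^ m + 14 - e) %% 15) %/ 3 + 1); lia.
have -> : offset_at_next_power r e =
    nth None [:: None; Some 6; Some 3; Some 0; Some 9] (i %% 5).
  by congr nth; lia.
pose j := (3 ^ m - e - 3 * i) %/ 15.
apply: (@cross_next_power m (2 * 3 ^ m + e + 15 * j)) => //; first by lia.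
by apply: (@period_leading2 m) => //; lia.
Qed.

(** Starts the iteration from an arbitrary path, which need not meet the multiples of 3 followed
    above. *)
Lemma enter_power m x : 2 < m -> x < 3 ^ m.+1 <= x + 8 -> V x ->
  exists2 e, e \in [:: 0; 3; 6; 9] & V (3 ^ m.+1 + e).
Proof.
move=> m_gt2 range_x Vx; have [M_eq M_big] := pow3_ge27_mul3 m_gt2.
have P_eq := expnS 3 m.
have [i i_in eq_x] : exists2 i, i \in iota 1 8 & x = 3 ^ m.+1 - i.
  by exists (3 ^ m.+1 - x); rewrite ?mem_iota; lia.
have from4 : V (3 ^ m.+1 - 4) -> exists2 e, e \in [:: 0; 3; 6; 9] & V (3 ^ m.+1 + e).
  by move=> V1; exists 3 => //; apply: (@goto_leading1 m.+1 _ _ V1); lia.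
have from1 : V (3 ^ m.+1 - 1) -> exists2 e, e \in [:: 0; 3; 6; 9] & V (3 ^ m.+1 + e).
  by move=> V1; exists 6 => //; apply: (@goto_leading1 m.+1 _ _ V1); lia.
have from3 : V (3 ^ m.+1 - 3) -> exists2 e, e \in [:: 0; 3; 6; 9] & V (3 ^ m.+1 + e).
  by move=> V1; apply: from1; apply: (@goto_leading2 m _ _ V1); lia.
rewrite eq_x in Vx; move: i_in Vx; rewrite /= !inE.
move=> /or4P[| | |/or4P[| | |/orP[]]] /eqP -> Vx.
- exact: from1.
- exists 9 => //; have V1 : V (3 ^ m.+1 + 2) by apply: (@goto_leading1 m.+1 _ _ Vx); lia.
  by apply: (@goto_leading1 m.+1 _ _ V1); lia.
- exact: from3.
- exact: from4.
- by have := @no_step m _ Vx; lia.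
- by apply: from4; apply: (@goto_leading2 m _ _ Vx); lia.
- by exists 0 => //; apply: (@goto_leading1 m.+1 _ _ Vx); lia.
- by apply: from3; apply: (@goto_leading2 m _ _ Vx); lia.
Qed.

Lemma next_power m r e : 2 < m -> 3 ^ m = r %[mod 60] -> r \in [:: 3; 9; 27; 21] ->
  e \in [:: 0; 3; 6; 9] -> V (3 ^ m + e) ->
  exists2 e', offset_at_next_power r (offset_at_two r e) = Some e'
            & V (3 ^ m.+1 + e').
Proof.
move=> m_gt2 mod_r r_in e_in Ve.
have [e_le e3] : e <= 9 /\ 3 %| e.
  by move: e_in; rewrite !inE => /or4P[]/eqP->.
have [o_le o3] : offset_at_two r e <= 12 /\ 3 %| offset_at_two r e.
  by move: r_in e_in; rewrite !inE => /or4P[]/eqP-> /or4P[]/eqP->.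
by apply: reach_next_power => //; apply: reach_two.
Qed.

End Steps.

(** * Every orbit of offsets ends, hence no infinite path *)

Lemma succ_closed_bounded V m : succ_closed V -> 2 < m -> 3 ^ m = 3 %[mod 60] ->
  forall e, e \in [:: 0; 3; 6; 9] -> ~ V (3 ^ m + e).
Proof.
move=> Vsucc m_gt2 mod0 e e_in V0.
have mod1 : 3 ^ m.+1 = 9 %[mod 60] by rewrite expnS; lia.
have mod2 : 3 ^ m.+2 = 27 %[mod 60] by rewrite expnS; lia.
have mod3 : 3 ^ m.+3 = 21 %[mod 60] by rewrite expnS; lia.
have mod4 : 3 ^ m.+4 = 3 %[mod 60] by rewrite expnS; lia.
have mod5 : 3 ^ m.+4.+1 = 9 %[mod 60] by rewrite expnS; lia.
(* With [k] on the left, [k + m] converts to the iterated successors of [m] for numeral [k]. *)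
have step k r e' : 3 ^ (k + m) = r %[mod 60] -> r \in [:: 3; 9; 27; 21] ->
    e' \in [:: 0; 3; 6; 9] -> V (3 ^ (k + m) + e') ->
    exists2 e'', offset_at_next_power r (offset_at_two r e') = Some e''
               & V (3 ^ (k.+1 + m) + e'').
  by apply: next_power => //; lia.
(* The longest orbit of offsets is 3, 9, 6, 6, 6, 0; its tail is refuted first, from the end. *)
have end9_0 : ~ V (3 ^ m.+4.+1 + 0).
  by move=> /(step 5 9 0 mod5 isT isT)[].
have end3_6 : ~ V (3 ^ m.+4 + 6).
  by move=> /(step 4 3 6 mod4 isT isT)[_ [<-]].
have end21_6 : ~ V (3 ^ m.+3 + 6).
  by move=> /(step 3 21 6 mod3 isT isT)[_ [<-]].
move: e_in V0; rewrite !inE => /or4P[]/eqP->.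
- by move=> /(step 0 3 0 mod0 isT isT)[].
- move=> /(step 0 3 3 mod0 isT isT)[_ [<-]].
  move=> /(step 1 9 9 mod1 isT isT)[_ [<-]].
  by move=> /(step 2 27 6 mod2 isT isT)[_ [<-]].
- move=> /(step 0 3 6 mod0 isT isT)[_ [<-]].
  by move=> /(step 1 9 0 mod1 isT isT)[].
- move=> /(step 0 3 9 mod0 isT isT)[_ [<-]].
  move=> /(step 1 9 3 mod1 isT isT)[_ [<-]].
  by move=> /(step 2 27 9 mod2 isT isT)[].
Qed.

Lemma crossing (u : nat -> nat) B d :
  (forall n, u n < u n.+1 <= u n + d) -> u 0 < B ->
  exists n, u n < B <= u n + d.
Proof.
move=> u_step u0_lt; have u_ge n : n <= u n.
  by elim: n => // n IHn; have := u_step n; lia.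
have ex_n : exists n, B <= u n by exists B.
have [[|n] Bn n_min] := ex_minnP ex_n; first by lia.
exists n; have := u_step n; case: (ltnP (u n) B) => [|/n_min]; lia.
Qed.

Theorem theorem9p1 :
  ~ exists a : nat -> nat,
      (forall n : nat, 1 <= n -> 0 < a n) /\
      infinite_path (successor_graph 3) a.
Proof.
move=> [a [_ path_a]].
pose V x := exists n, x = a n.+1.
have Vsucc : succ_closed V.
  by move=> _ [n ->]; exists (a n.+2); [exact: path_a | exists n.+1].
(* A multiple of 4 makes [3 ^ m.+1] congruent to 3 modulo 60, and this one puts that power above
   [a 1]. *)
pose m := 4 * (a 1).+1.
have mod3 : 3 ^ m.+1 = 3 %[mod 60].
  rewrite expnS {}/m; elim: (a 1).+1 => // k.
  by rewrite mulnS expnD -[3 ^ 4]/81; lia.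
(* The largest possible increment is 3 * 2 + 2 = 8. *)
have [n||n range_n] := @crossing (fun n => a n.+1) (3 ^ m.+1) 8.
- have [/comma_child3_cases[eq_a dig_a] _] := path_a n.+1 isT.
  by case: dig_a eq_a => ->; lia.
- have := ltn_expl m.+1 (isT : 1 < 3); lia.
have m_gt2 : 2 < m by rewrite /m; lia.
have [|e e_in] := @enter_power V Vsucc m _ m_gt2 range_n; first by exists n.
by apply: (@succ_closed_bounded V m.+1) => //; lia.
Qed.
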